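(* Assume $\varepsilon>2M$. Then for all $\boldsymbol{\alpha}=(\alpha_1,\alpha_2)\in\mathcal{D}_{+-}=\mathrm{UHP}_1\times\mathrm{LHP}_2$ and all $\varphi\in[\tfrac{3\pi}{2},2\pi]$ one has $\operatorname{Re}\bigl(-i(\alpha_1\cos\varphi+\alpha_2\sin\varphi+i\varepsilon)\bigr)>0$ (in particular the denominator below never vanishes), and the function $$I_{+-}^{\varepsilon}(\alpha_1,\alpha_2)=\int_{\frac{3\pi}{2}}^{2\pi}\frac{f\left(\frac{\pi}{2},\varphi\right)}{\bigl(-i(\alpha_1\cos\varphi+\alpha_2\sin\varphi+i\varepsilon)\bigr)^{\nu+3/2}}\,d\varphi$$ is analytic (as a function of two complex variables) on $\mathcal{D}_{+-}$.
   Context: Contours and half-planes. For $j=1,2$, $\mathcal{A}_j$ is an integration contour in the complex $\alpha_j$-plane running from $-\infty$ to $+\infty$, which coincides with the real axis outside a bounded (indented) part. $\mathrm{UHP}_j$ denotes the set of points lying on and above $\mathcal{A}_j$, and $\mathrm{LHP}_j$ the set of points lying on and below $\mathcal{A}_j$. The constant $M>0$, depending on the contours, is such that $\operatorname{Im}\alpha_1\ge -M$ for all $\alpha_1\in\mathrm{UHP}_1$ and $\operatorname{Im}\alpha_2\le M$ for all $\alpha_2\in\mathrm{LHP}_2$. ''Analytic on'' one of these sets, which contain their boundary contours, means analytic in a neighbourhood of the set. Eigenfunction and exponent. Let $\ell_1$ be the first (smallest) eigenvalue of (minus) the Laplace-Beltrami operator on the unit sphere, with spherical coordinates $(\theta,\varphi)$,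 with Dirichlet condition on the cut $\{\theta=\pi/2,\ \varphi\in[0,\pi/2]\}$; let $f(\theta,\varphi)$ be the associated first eigenfunction, and $\nu=\sqrt{\ell_1+1/4}\approx 0.7967$. The following properties of $f$ are taken as known: $f(\pi/2,\varphi)=0$ for $\varphi\in[0,\pi/2]$; $f(\pi/2,\cdot)$ is smooth with $0<f(\pi/2,\varphi)\le 1$ on $(\pi/2,2\pi)$; $f(\pi/2,\varphi)=\mathcal{O}(\sqrt{\varphi-\pi/2})$ as $\varphi\to\pi/2^+$ and $\mathcal{O}(\sqrt{2\pi-\varphi})$ as $\varphi\to 2\pi^-$; $f(\pi/2,\cdot)$ is strictly decreasing on $[3\pi/2,2\pi]$. Complex powers $\mu^{\nu+3/2}$ with $\operatorname{Re}\mu>0$ are principal values. *)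

(* Defs.v *)
From Stdlib Require Import Reals.
From Coquelicot Require Import Coquelicot.
Open Scope R_scope.

(** * Contours and half-planes *)

Definition on_contour (gamma : R -> C) (z : C) : Prop :=
  exists t : R, gamma t = z.

(* [gamma] agrees on [[a, b]] with a function that is C^1 on the whole line,
   i.e. it is C^1 on [[a, b]] with one-sided derivatives at the end points. *)
Definition C1_arc (gamma : R -> C) (a b : R) : Prop :=
  exists g dg : R -> C,
    (forall t, is_derive (V := C_R_NormedModule) g t (dg t)) /\
    (forall t, continuous dg t) /\
    (forall t, a <= t <= b -> gamma t = g t).

(* A simple, piecewise C^1 curve, parametrized from -infinity to +infinity,
   which is the real axis outside a bounded part. *)
Definition is_contour (gamma : R -> C) : Prop :=
  (forall t, continuous gamma t) /\
  (forall s t, gamma s = gamma t -> s = t) /\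
  exists (T : R) (n : nat) (s : nat -> R),
    (forall t, T <= Rabs t -> gamma t = RtoC t) /\
    s 0%nat = - T /\ s n = T /\
    (forall k, (k < n)%nat -> s k < s (S k) /\ C1_arc gamma (s k) (s (S k))).

Definition joined_off (gamma : R -> C) (z w : C) : Prop :=
  exists p : R -> C,
    (forall t, continuous p t) /\ p 0 = z /\ p 1 = w /\
    (forall t, 0 <= t <= 1 -> ~ on_contour gamma (p t)).

(* The complement of the contour has two components; the upper one is the one
   that contains the points higher than every point of the contour. *)
Definition strictly_above (gamma : R -> C) (z : C) : Prop :=
  exists w : C, joined_off gamma z w /\ (forall t, Im (gamma t) < Im w).

Definition strictly_below (gamma : R -> C) (z : C) : Prop :=
  exists w : C, joined_off gamma z w /\ (forall t, Im w < Im (gamma t)).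

Definition UHP (gamma : R -> C) (z : C) : Prop :=
  on_contour gamma z \/ strictly_above gamma z.

Definition LHP (gamma : R -> C) (z : C) : Prop :=
  on_contour gamma z \/ strictly_below gamma z.

(** * The Dirichlet problem on the slit sphere *)

Definition point3 : Type := (R * R * R)%type.

Definition norm3 (p : point3) : R :=
  sqrt (fst (fst p) ^ 2 + snd (fst p) ^ 2 + snd p ^ 2).

Definition on_sphere (p : point3) : Prop := norm3 p = 1.

Definition normalize (p : point3) : point3 :=
  (fst (fst p) / norm3 p, snd (fst p) / norm3 p, snd p / norm3 p).

Definition spherical (theta phi : R) : point3 :=
  (sin theta * cos phi, sin theta * sin phi, cos theta).

Definition in_cut (p : point3) : Prop :=
  exists phi, 0 <= phi <= PI / 2 /\ p = spherical (PI / 2) phi.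

Inductive axis : Set := X1 | X2 | X3.

Definition coordinate (i : axis) (p : point3) : R :=
  match i with X1 => fst (fst p) | X2 => snd (fst p) | X3 => snd p end.

Definition set_coordinate (i : axis) (p : point3) (t : R) : point3 :=
  match i with
  | X1 => (t, snd (fst p), snd p)
  | X2 => (fst (fst p), t, snd p)
  | X3 => (fst (fst p), snd (fst p), t)
  end.

Definition ex_partial (i : axis) (U : point3 -> R) (p : point3) : Prop :=
  ex_derive (fun t => U (set_coordinate i p t)) (coordinate i p).

Definition partial (i : axis) (U : point3 -> R) (p : point3) : R :=
  Derive (fun t => U (set_coordinate i p t)) (coordinate i p).

Definition C2_on (Omega : point3 -> Prop) (U : point3 -> R) : Prop :=
  forall p, Omega p ->
    continuous U p /\
    forall i, ex_partial i U p /\ continuous (partial i U) p /\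
      forall j, ex_partial j (partial i U) p /\
                continuous (partial j (partial i U)) p.

(* Extension of a function on the unit sphere to R^3 minus the origin,
   homogeneous of degree 0. *)
Definition extend (u : point3 -> R) (p : point3) : R := u (normalize p).

(* At a point of the unit sphere, the Laplace-Beltrami operator is the Euclidean
   Laplacian of the extension that is homogeneous of degree 0. In spherical
   coordinates this is
   (1 / sin theta) d_theta (sin theta d_theta u)
   + (1 / sin^2 theta) d_phi^2 u, but it also makes sense at the poles. *)
Definition laplace_beltrami (u : point3 -> R) (p : point3) : R :=
  partial X1 (partial X1 (extend u)) p +
  partial X2 (partial X2 (extend u)) p +
  partial X3 (partial X3 (extend u)) p.

(* Only the values of [u] on the unit sphere matter. The first condition says
   that [u] is continuous on the whole sphere, so the boundary values on the
   cut are attained. *)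
Definition dirichlet_eigenpair (l : R) (u : point3 -> R) : Prop :=
  (forall p, norm3 p <> 0 -> continuous (extend u) p) /\
  C2_on (fun p => norm3 p <> 0 /\ ~ in_cut (normalize p)) (extend u) /\
  (forall p, on_sphere p -> ~ in_cut p -> - laplace_beltrami u p = l * u p) /\
  (forall p, in_cut p -> u p = 0) /\
  (exists p, on_sphere p /\ u p <> 0).

Definition first_dirichlet_eigenpair (l : R) (u : point3 -> R) : Prop :=
  dirichlet_eigenpair l u /\
  forall l' u', dirichlet_eigenpair l' u' -> l <= l'.

Definition eigenfunction_properties (f : R -> R -> R) : Prop :=
  (forall phi, 0 <= phi <= PI / 2 -> f (PI / 2) phi = 0) /\
  (forall n phi, PI / 2 < phi < 2 * PI -> ex_derive_n (f (PI / 2)) n phi) /\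
  (forall phi, PI / 2 < phi < 2 * PI -> 0 < f (PI / 2) phi <= 1) /\
  (exists K, at_right (PI / 2)
     (fun phi => Rabs (f (PI / 2) phi) <= K * sqrt (phi - PI / 2))) /\
  (exists K, at_left (2 * PI)
     (fun phi => Rabs (f (PI / 2) phi) <= K * sqrt (2 * PI - phi))) /\
  (forall phi psi, 3 * PI / 2 <= phi -> phi < psi -> psi <= 2 * PI ->
     f (PI / 2) psi < f (PI / 2) phi).

(** * Principal powers *)

(* Values in (-PI, PI] for z <> 0. *)
Definition Carg (z : C) : R :=
  if Rlt_dec 0 (Re z) then atan (Im z / Re z)
  else if Rlt_dec 0 (Im z) then PI / 2 - atan (Re z / Im z)
  else if Rlt_dec (Im z) 0 then - (PI / 2) - atan (Re z / Im z)
  else PI.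

Definition Clog (z : C) : C := (ln (Cmod z), Carg z).

Definition Cexp (z : C) : C :=
  (exp (Re z) * cos (Im z), exp (Re z) * sin (Im z)).

Definition Cpower (z : C) (s : R) : C := Cexp (RtoC s * Clog z)%C.

(** * Analytic functions of two complex variables *)

(* On a bidisc centred at [a], [F] is the sum of an absolutely convergent double
   power series, summed by total degree. *)
Definition analytic_at (F : C * C -> C) (a : C * C) : Prop :=
  exists (r : R) (c : nat -> nat -> C), 0 < r /\
    forall h1 h2 : C, Cmod h1 < r -> Cmod h2 < r ->
      ex_series (fun n => sum_n (fun k =>
        Cmod (c k (n - k)%nat) * Cmod h1 ^ k * Cmod h2 ^ (n - k)) n) /\
      is_series (V := C_NormedModule)
        (fun n => sum_n (G := C_AbelianMonoid) (fun k =>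
           (c k (n - k)%nat * Cpow h1 k * Cpow h2 (n - k))%C) n)
        (F ((fst a + h1)%C, (snd a + h2)%C)).

(* The set [D] need not be open. *)
Definition analytic_on (D : C * C -> Prop) (F : C * C -> C) : Prop :=
  exists W : C * C -> Prop,
    open W /\ (forall a, D a -> W a) /\ (forall a, W a -> analytic_at F a).

(** * The integral *)

Definition base (eps : R) (a : C * C) (phi : R) : C :=
  (- Ci * (fst a * RtoC (cos phi) + snd a * RtoC (sin phi)
           + Ci * RtoC eps))%C.

Definition integrand (f : R -> R -> R) (nu eps : R) (a : C * C) (phi : R) : C :=
  (RtoC (f (PI / 2)%R phi) / Cpower (base eps a phi) (nu + 3 / 2)%R)%C.

Definition I_pm (f : R -> R -> R) (nu eps : R) (a : C * C) : C :=
  RInt (V := C_R_CompleteNormedModule)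
    (integrand f nu eps a) (3 * PI / 2) (2 * PI).

(* Main.v *)
Require Import Defs.
From Stdlib Require Import Reals Lra Lia.
From Coquelicot Require Import Coquelicot.
Open Scope R_scope.

(** On the arc [[3 PI / 2, 2 PI]] the cosine is nonnegative and the sine
    nonpositive, so that [Im a1 >= - M] and [Im a2 <= M] give
    [Re (base eps a phi) >= eps - 2 M], a positive bound that does not depend on
    [phi] ([Re_base_lower_bound]). The same bound with some [m] between [M] and
    [eps / 2] in place of [M] holds on the open set [Im a1 > - m], [Im a2 < m],
    which contains [D] and serves as the domain of analyticity.

    The weight [f (PI / 2)] is continuous, because the eigenfunction is continuous
    on the whole sphere, and bounded by 1. So the integral is a proper one, with
    integrand [g(t) / (b(t) + L(t)) ^ s], where [b] is the base at the centre, [L]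
    is linear in the increments [h1], [h2], and [Re b >= delta > 0] uniformly. It
    remains to expand in a binomial series,
      [(b + L) ^ (- s) = sum_n binom (- s, n) b ^ (- s) (L / b) ^ n],
    to expand [L ^ n] by the binomial theorem, and to integrate term by term. The
    integrals of the resulting coefficients are the double power series
    ([analytic_at_power_integral]).

    The analytic core is [binomial_remainder], an estimate of the remainder that
    is uniform in [t], which gives both the binomial series and the exchange of
    sum and integral. It comes from moving the centre of the expansion along the
    segment from [b] to [b + L]: the expansion about [z(t) = b + t L], evaluated at
    [b + L], equals the partial sum at [t = 0] and [(b + L) ^ (- s)] at [t = 1],
    and its derivative in [t] telescopes to a single term
    ([telescoping_derivative]). An increment of a complex function is controlled by
    the real mean value theorem on its components. As a power series on some bidisc
    suffices, the crude bound [(1 + s) ^ n] for the binomial coefficients is good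
    enough, at the price of the small radius [delta / (8 (1 + s))]. *)

(** * Derivatives of complex functions of a real variable *)

(** Componentwise derivative with respect to a real variable. It lets products,
    inverses and powers be differentiated with the real rules. *)
Definition is_derive_C (g : R -> C) (t : R) (d : C) : Prop :=
  is_derive (fun x => Re (g x)) t (Re d) /\
  is_derive (fun x => Im (g x)) t (Im d).

Lemma is_derive_C_ext (g h : R -> C) (t : R) (d : C) :
  (forall x, g x = h x) -> is_derive_C g t d -> is_derive_C h t d.
Proof.
  intros Hgh [H1 H2]; split.
  - apply (is_derive_ext (fun x => Re (g x))); [intros x; now rewrite Hgh | exact H1].
  - apply (is_derive_ext (fun x => Im (g x))); [intros x; now rewrite Hgh | exact H2].
Qed.

Lemma is_derive_C_eq (g : R -> C) (t : R) (d d' : C) :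
  is_derive_C g t d -> d = d' -> is_derive_C g t d'.
Proof. now intros H <-. Qed.

Lemma is_derive_C_const (c : C) (t : R) : is_derive_C (fun _ => c) t 0%C.
Proof.
  split.
  - exact (is_derive_const (V := R_NormedModule) (Re c) t).
  - exact (is_derive_const (V := R_NormedModule) (Im c) t).
Qed.

Lemma is_derive_C_RtoC (g : R -> R) (t d : R) :
  is_derive g t d -> is_derive_C (fun x => RtoC (g x)) t (RtoC d).
Proof. intros H; split; [exact H | exact (is_derive_const (V := R_NormedModule) 0 t)]. Qed.

Lemma is_derive_C_plus (g h : R -> C) (t : R) (dg dh : C) :
  is_derive_C g t dg -> is_derive_C h t dh ->
  is_derive_C (fun x => g x + h x)%C t (dg + dh)%C.
Proof.
  intros [G1 G2] [H1 H2]; split.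
  - exact (is_derive_plus _ _ _ _ _ G1 H1).
  - exact (is_derive_plus _ _ _ _ _ G2 H2).
Qed.

Lemma is_derive_C_mult (g h : R -> C) (t : R) (dg dh : C) :
  is_derive_C g t dg -> is_derive_C h t dh ->
  is_derive_C (fun x => g x * h x)%C t (dg * h t + g t * dh)%C.
Proof.
  assert (Hreal : forall (a b : R -> R) (da db : R),
    is_derive a t da -> is_derive b t db ->
    is_derive (fun x => a x * b x) t (da * b t + a t * db)).
  { intros a b da db Ha Hb. exact (is_derive_mult a b t da db Ha Hb Rmult_comm). }
  intros [G1 G2] [H1 H2]; split.
  - replace (Re (dg * h t + g t * dh)%C) with
      ((Re dg * Re (h t) + Re (g t) * Re dh) -
       (Im dg * Im (h t) + Im (g t) * Im dh))
      by (unfold Re, Im; simpl; ring).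
    exact (is_derive_minus _ _ _ _ _ (Hreal _ _ _ _ G1 H1) (Hreal _ _ _ _ G2 H2)).
  - replace (Im (dg * h t + g t * dh)%C) with
      ((Re dg * Im (h t) + Re (g t) * Im dh) +
       (Im dg * Re (h t) + Im (g t) * Re dh))
      by (unfold Re, Im; simpl; ring).
    exact (is_derive_plus _ _ _ _ _ (Hreal _ _ _ _ G1 H2) (Hreal _ _ _ _ G2 H1)).
Qed.

Lemma is_derive_C_pow (g : R -> C) (t : R) (d : C) (n : nat) :
  is_derive_C g t d ->
  is_derive_C (fun x => Cpow (g x) n) t (RtoC (INR n) * Cpow (g t) (pred n) * d)%C.
Proof.
  intros Hg; induction n as [|n IH].
  - replace (RtoC (INR 0) * _ * d)%C with (RtoC 0) by (simpl; ring).
    apply (is_derive_C_ext (fun _ => RtoC 1)); [now intros x|].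
    exact (is_derive_C_const (RtoC 1) t).
  - apply (is_derive_C_ext (fun x => g x * Cpow (g x) n)%C).
    { reflexivity. }
    replace (RtoC (INR (S n)) * Cpow (g t) (pred (S n)) * d)%C with
      (d * Cpow (g t) n + g t * (RtoC (INR n) * Cpow (g t) (pred n) * d))%C.
    { now apply is_derive_C_mult. }
    rewrite S_INR, RtoC_plus.
    destruct n as [|n]; cbn [pred]; [simpl; ring | rewrite Cpow_S; ring].
Qed.

Lemma is_derive_C_inv (z : R -> C) (t : R) (d : C) :
  is_derive_C z t d -> 0 < Re (z t) ->
  is_derive_C (fun x => / z x)%C t (- d / (z t * z t))%C.
Proof.
  assert (Hreal : forall (a b : R -> R) (da db : R),
    is_derive a t da -> is_derive b t db -> 0 < a t ->
    is_derive (fun x => a x / (a x ^ 2 + b x ^ 2)) t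
      (Re (- (da, db) / ((a t, b t) * (a t, b t)))%C) /\
    is_derive (fun x => - b x / (a x ^ 2 + b x ^ 2)) t
      (Im (- (da, db) / ((a t, b t) * (a t, b t)))%C)).
  { intros a b da db Ha Hb Hpos.
    assert (Da : Derive (fun x : R => a x) t = da) by exact (is_derive_unique _ _ _ Ha).
    assert (Db : Derive (fun x : R => b x) t = db) by exact (is_derive_unique _ _ _ Hb).
    assert (Hq : 0 < a t * a t + b t * b t) by nra.
    split; auto_derive;
      try (repeat split; try (eexists; eassumption); simpl; nra);
      rewrite Da, Db;
      unfold Re, Im; simpl; field; split; nra. }
  intros [H1 H2] Hz.
  destruct (Hreal _ _ _ _ H1 H2 Hz) as [K1 K2].
  replace (- d / (z t * z t))%C with
    (- (Re d, Im d) / ((Re (z t), Im (z t)) * (Re (z t), Im (z t))))%C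
    by now destruct d, (z t).
  split; [exact K1 | exact K2].
Qed.

Lemma Cmod_le_Rabs (z : C) : Cmod z <= Rabs (Re z) + Rabs (Im z).
Proof.
  replace z with (RtoC (Re z) + Ci * RtoC (Im z))%C at 1
    by (destruct z; unfold Re, Im, RtoC, Ci, Cplus, Cmult; simpl; f_equal; ring).
  eapply Rle_trans; [apply Cmod_triangle|].
  rewrite Cmod_mult, Cmod_Ci, !Cmod_R. lra.
Qed.

(** The mean value theorem fails for complex values. Applied to the two components
    it gives the usual bound up to a factor 2. *)
Lemma Cmod_increment_le (g dg : R -> C) (D : R) :
  (forall t, 0 <= t <= 1 -> is_derive_C g t (dg t) /\ Cmod (dg t) <= D) ->
  Cmod (g 1 - g 0)%C <= 2 * D.
Proof.
  intros H.
  assert (Hreal : forall h dh : R -> R,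
    (forall t, 0 <= t <= 1 -> is_derive h t (dh t) /\ Rabs (dh t) <= D) ->
    Rabs (h 1 - h 0) <= D).
  { intros h dh Hh.
    destruct (MVT_gen h 0 1 dh) as [t [Ht Heq]];
      rewrite ?Rmin_left, ?Rmax_right in * by lra.
    - intros x Hx. apply Hh. lra.
    - intros x Hx. apply continuity_pt_filterlim.
      apply (ex_derive_continuous (V := R_NormedModule)).
      eexists. now apply Hh.
    - rewrite Heq. replace (dh t * (1 - 0)) with (dh t) by ring. now apply Hh. }
  assert (HRe : Rabs (Re (g 1) - Re (g 0)) <= D).
  { apply (Hreal (fun t => Re (g t)) (fun t => Re (dg t))).
    intros t Ht. destruct (H t Ht) as [[K _] N]. split; [exact K|].
    eapply Rle_trans; [apply re_le_Cmod | exact N]. }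
  assert (HIm : Rabs (Im (g 1) - Im (g 0)) <= D).
  { apply (Hreal (fun t => Im (g t)) (fun t => Im (dg t))).
    intros t Ht. destruct (H t Ht) as [[_ K] N]. split; [exact K|].
    eapply Rle_trans; [|exact N].
    eapply Rle_trans; [apply Rmax_r | apply Rmax_Cmod]. }
  eapply Rle_trans; [apply Cmod_le_Rabs|].
  replace (2 * D) with (D + D) by ring.
  exact (Rplus_le_compat _ _ _ _ HRe HIm).
Qed.

(** * Principal powers in the right half-plane *)

Lemma Re_pos_neq_0 (z : C) : 0 < Re z -> z <> 0%C.
Proof. intros H E. rewrite E in H. simpl in H. lra. Qed.

Lemma Re_le_Cmod (z : C) : Re z <= Cmod z.
Proof. eapply Rle_trans; [apply Rle_abs | apply re_le_Cmod]. Qed.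

(** For [Re z > 0] the argument is the arctangent, so the power is an explicit
    smooth function of the real and imaginary parts. *)
Lemma Cinv_Cpower (z : C) (s : R) : 0 < Re z ->
  (/ Cpower z s)%C =
  (exp (- s * ln (Cmod z)) * cos (s * atan (Im z / Re z)),
   - (exp (- s * ln (Cmod z)) * sin (s * atan (Im z / Re z)))).
Proof.
  intros Hz.
  unfold Cpower, Cexp, Clog, Carg.
  destruct (Rlt_dec 0 (Re z)) as [_|n]; [|contradiction].
  set (m := ln (Cmod z)). set (th := atan (Im z / Re z)).
  replace (RtoC s * (m, th))%C with ((s * m, s * th) : C)
    by (unfold RtoC, Cmult; simpl; f_equal; ring).
  unfold Re, Im, Cinv; simpl fst; simpl snd.
  replace (- s * m) with (- (s * m)) by ring. rewrite exp_Ropp.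
  pose proof (exp_pos (s * m)) as He.
  pose proof (sin2_cos2 (s * th)) as Hsc. unfold Rsqr in Hsc.
  replace ((exp (s * m) * cos (s * th)) ^ 2 + (exp (s * m) * sin (s * th)) ^ 2)
    with (exp (s * m) * exp (s * m) *
          (sin (s * th) * sin (s * th) + cos (s * th) * cos (s * th))) by ring.
  rewrite Hsc. f_equal; field; lra.
Qed.

Lemma Cmod_Cinv_Cpower (z : C) (s : R) : 0 < Re z ->
  Cmod (/ Cpower z s) = exp (- s * ln (Cmod z)).
Proof.
  intros Hz. rewrite Cinv_Cpower by exact Hz. unfold Cmod at 1; simpl fst; simpl snd.
  set (E := exp _). set (th := s * _).
  assert (HE : 0 <= E) by (left; apply exp_pos).
  pose proof (sin2_cos2 th) as Hsc. unfold Rsqr in Hsc.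
  replace ((E * cos th) ^ 2 + (- (E * sin th)) ^ 2)
    with (E ^ 2 * (sin th * sin th + cos th * cos th)) by ring.
  rewrite Hsc, Rmult_1_r. now apply sqrt_pow2.
Qed.

Lemma Cmod_Cinv_Cpower_le (z : C) (s d : R) : 0 <= s -> 0 < d -> d <= Re z ->
  Cmod (/ Cpower z s) <= exp (- s * ln d).
Proof.
  intros Hs Hd Hz. rewrite Cmod_Cinv_Cpower by lra.
  assert (Hln : ln d <= ln (Cmod z)).
  { apply ln_le; [lra|]. pose proof (Re_le_Cmod z); lra. }
  assert (Hle : - s * ln (Cmod z) <= - s * ln d) by nra.
  destruct Hle as [Hlt|Heq]; [left; now apply exp_increasing | right; now rewrite Heq].
Qed.

Lemma ln_Cmod (z : C) : 0 < Re z ->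
  ln (Cmod z) = ln (Re z ^ 2 + Im z ^ 2) / 2.
Proof.
  intros Hz.
  assert (Hm : 0 < Cmod z) by (pose proof (Re_le_Cmod z); lra).
  rewrite <- Cmod2_alt. simpl. rewrite Rmult_1_r, ln_mult by exact Hm. field.
Qed.

(** The chain rule for the principal power [z ^ (- s)] along a curve in the right
    half-plane. *)
Lemma is_derive_C_inv_power (z : R -> C) (t s : R) (d : C) :
  is_derive_C z t d -> 0 < Re (z t) ->
  is_derive_C (fun x => / Cpower (z x) s)%C t
    (- RtoC s * (d / z t) * / Cpower (z t) s)%C.
Proof.
  (* differentiate the polar form in the two real variables *)
  pose (modulus := fun x y => exp (- s * (ln (x ^ 2 + y ^ 2) / 2))).
  pose (angle := fun x y => s * atan (y / x)).
  assert (Hpolar : forall w : C, 0 < Re w -> (/ Cpower w s)%C =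
    (modulus (Re w) (Im w) * cos (angle (Re w) (Im w)),
     - (modulus (Re w) (Im w) * sin (angle (Re w) (Im w))))).
  { intros w Hw. unfold modulus, angle. now rewrite Cinv_Cpower, ln_Cmod. }
  assert (Hreal : forall (a b : R -> R) (da db : R),
    is_derive a t da -> is_derive b t db -> 0 < a t ->
    let E := (modulus (a t) (b t) * cos (angle (a t) (b t)),
              - (modulus (a t) (b t) * sin (angle (a t) (b t)))) : C in
    is_derive (fun x => modulus (a x) (b x) * cos (angle (a x) (b x))) t
      (Re (- RtoC s * ((da, db) / (a t, b t)) * E)%C) /\
    is_derive (fun x => - (modulus (a x) (b x) * sin (angle (a x) (b x)))) t
      (Im (- RtoC s * ((da, db) / (a t, b t)) * E)%C)).
  { intros a b da db Ha Hb Hpos.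
    assert (Da : Derive (fun x : R => a x) t = da) by exact (is_derive_unique _ _ _ Ha).
    assert (Db : Derive (fun x : R => b x) t = db) by exact (is_derive_unique _ _ _ Hb).
    unfold modulus, angle.
    assert (Hq : 0 < a t * a t + b t * b t) by nra.
    split; auto_derive;
      try (repeat split; try (eexists; eassumption); simpl; nra);
      rewrite Da, Db;
      unfold Re, Im, Rsqr, Rdiv; simpl;
      generalize (exp (- s * (ln (a t * (a t * 1) + b t * (b t * 1)) * / 2)));
      generalize (cos (s * atan (b t * / a t)));
      generalize (sin (s * atan (b t * / a t)));
      intros sn cs md; field; repeat split; nra. }
  intros [H1 H2] Hz.
  (* the polar form holds only where the real part is positive *)
  assert (Hloc : locally t (fun x => 0 < Re (z x))).
  { assert (Hc : continuous (fun x => Re (z x)) t)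
      by (apply (ex_derive_continuous (V := R_NormedModule)); eexists; eassumption).
    apply Hc. apply (open_gt 0). exact Hz. }
  destruct (Hreal _ _ _ _ H1 H2 Hz) as [K1 K2].
  rewrite Hpolar by exact Hz.
  replace (d / z t)%C with ((Re d, Im d) / (Re (z t), Im (z t)))%C
    by now destruct d, (z t).
  split.
  - eapply is_derive_ext_loc; [|exact K1].
    revert Hloc; apply filter_imp; intros x Hx. now rewrite Hpolar.
  - eapply is_derive_ext_loc; [|exact K2].
    revert Hloc; apply filter_imp; intros x Hx. now rewrite Hpolar.
Qed.

(** * Finite sums and the binomial theorem *)

(** Pins the monoid structure, which the additive structures on [C] would
    otherwise leave to unification. *)
Definition Csum (u : nat -> C) (n : nat) : C := sum_n (G := C_AbelianMonoid) u n.

Lemma Csum_0 (u : nat -> C) : Csum u 0 = u 0%nat.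
Proof. exact (sum_O (G := C_AbelianMonoid) u). Qed.

Lemma Csum_S (u : nat -> C) (n : nat) : Csum u (S n) = (Csum u n + u (S n))%C.
Proof. exact (sum_Sn (G := C_AbelianMonoid) u n). Qed.

Lemma Csum_ext (u v : nat -> C) (n : nat) :
  (forall k, (k <= n)%nat -> u k = v k) -> Csum u n = Csum v n.
Proof. exact (sum_n_ext_loc (G := C_AbelianMonoid) u v n). Qed.

Lemma Csum_mult_l (x : C) (u : nat -> C) (n : nat) :
  Csum (fun k => x * u k)%C n = (x * Csum u n)%C.
Proof.
  induction n as [|n IH]; rewrite ?Csum_0, ?Csum_S, ?IH; [easy | ring].
Qed.

Lemma Csum_plus (u v : nat -> C) (n : nat) :
  Csum (fun k => u k + v k)%C n = (Csum u n + Csum v n)%C.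
Proof.
  induction n as [|n IH]; rewrite ?Csum_0, ?Csum_S, ?IH; [easy | ring].
Qed.

Lemma Csum_shift (u : nat -> C) (n : nat) :
  Csum u (S n) = (u 0%nat + Csum (fun k => u (S k)) n)%C.
Proof.
  induction n as [|n IH].
  - now rewrite Csum_S, !Csum_0.
  - rewrite Csum_S, IH, (Csum_S (fun k => u (S k))). ring.
Qed.

Lemma Cbinomial (x y : C) (n : nat) :
  Cpow (x + y) n =
  Csum (fun k => RtoC (Binomial.C n k) * Cpow x k * Cpow y (n - k))%C n.
Proof.
  assert (Hn0 : forall n, Binomial.C n 0 = 1).
  { intros m. unfold Binomial.C. rewrite Nat.sub_0_r. simpl. field.
    apply INR_fact_neq_0. }
  assert (Hnn : forall n, Binomial.C n n = 1).
  { intros m. unfold Binomial.C. rewrite Nat.sub_diag. simpl. field.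
    apply INR_fact_neq_0. }
  induction n as [|n IH].
  - rewrite Csum_0, Hn0. simpl. ring.
  - rewrite Cpow_S, IH.
    replace ((x + y) * Csum (fun k => RtoC (Binomial.C n k) * Cpow x k * Cpow y (n - k)) n)%C
      with (Csum (fun k => RtoC (Binomial.C n k) * Cpow x (S k) * Cpow y (n - k)) n +
            Csum (fun k => RtoC (Binomial.C n k) * Cpow x k * Cpow y (S n - k)) n)%C.
    2:{ rewrite <- Csum_mult_l, <- Csum_plus. apply Csum_ext. intros k Hk.
        rewrite Nat.sub_succ_l by exact Hk. rewrite !Cpow_S. ring. }
    destruct n as [|n].
    { rewrite !Csum_S, !Csum_0, !Hn0, !Hnn. simpl. ring. }
    rewrite (Csum_S _ n), (Csum_shift _ n), (Csum_S _ (S n)), (Csum_shift _ n).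
    rewrite !Hn0, !Hnn, !Nat.sub_diag.
    rewrite (Csum_ext (fun k => RtoC (Binomial.C (S (S n)) (S k)) * Cpow x (S k) *
        Cpow y (S (S n) - S k))%C
      (fun k => RtoC (Binomial.C (S n) k) * Cpow x (S k) * Cpow y (S n - k) +
        RtoC (Binomial.C (S n) (S k)) * Cpow x (S k) * Cpow y (S (S n) - S k))%C).
    2:{ intros k Hk. rewrite <- pascal by lia. rewrite RtoC_plus, Nat.sub_succ. ring. }
    rewrite Csum_plus. ring.
Qed.

(** * The binomial series and its remainder *)

(** The generalized binomial coefficient [binom (- s, n)]. *)
Fixpoint neg_binomial (s : R) (n : nat) : R :=
  match n with
  | O => 1
  | S m => - neg_binomial s m * (s + INR m) / INR (S m)
  end.

(** Consecutive coefficients have a ratio of modulus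
    [(s + n) / (n + 1) <= 1 + s]. *)
Lemma neg_binomial_bound (s : R) (n : nat) : 0 <= s ->
  Rabs (neg_binomial s n) <= (1 + s) ^ n.
Proof.
  intros Hs. induction n as [|n IH].
  - simpl. rewrite Rabs_R1. lra.
  - cbn [neg_binomial pow].
    pose proof (pos_INR n) as Hn. pose proof (S_INR n) as HS.
    replace (- neg_binomial s n * (s + INR n) / INR (S n)) with
      (- neg_binomial s n * ((s + INR n) / INR (S n))) by (field; lra).
    rewrite Rabs_mult, Rabs_Ropp, (Rmult_comm (1 + s)).
    apply Rmult_le_compat; try apply Rabs_pos; [exact IH|].
    rewrite Rabs_pos_eq.
    + apply Rle_div_l; [lra|]. rewrite HS. nra.
    + apply Rdiv_le_0_compat; lra.
Qed.

(** The factor [s + n] turns the ratio into [(s + n + 1) / (n + 1)], which still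
    does not exceed [1 + s]. *)
Lemma neg_binomial_tail_bound (s : R) (n : nat) : 0 <= s ->
  Rabs ((s + INR n) * neg_binomial s n) <= s * (1 + s) ^ n.
Proof.
  intros Hs. induction n as [|n IH].
  - simpl. rewrite Rabs_pos_eq; lra.
  - cbn [neg_binomial pow].
    pose proof (pos_INR n) as Hn. pose proof (S_INR n) as HS.
    replace ((s + INR (S n)) * (- neg_binomial s n * (s + INR n) / INR (S n))) with
      (- ((s + INR n) * neg_binomial s n) * ((s + INR (S n)) / INR (S n)))
      by (field; lra).
    rewrite Rabs_mult, Rabs_Ropp.
    replace (s * ((1 + s) * (1 + s) ^ n)) with (s * (1 + s) ^ n * (1 + s)) by ring.
    apply Rmult_le_compat; try apply Rabs_pos; [exact IH|].
    rewrite Rabs_pos_eq.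
    + apply Rle_div_l; [lra|]. rewrite HS. nra.
    + apply Rdiv_le_0_compat; lra.
Qed.

(** The hypotheses hold for [E = z ^ (- s)] and [w = (1 - t) L / z], where
    [z = b + t L] and [q = L / z]. The derivative of the [k]-th term is then
    [- q E a_k ((s + k) w ^ k + k w ^ (k - 1))], with [a_k] the binomial
    coefficient, and [(s + k) a_k + (k + 1) a_(k+1) = 0] cancels all powers but the
    last. *)
Lemma telescoping_derivative (E w : R -> C) (t s : R) (q : C) (n : nat) :
  is_derive_C E t (- RtoC s * q * E t)%C ->
  is_derive_C w t (- q * (1 + w t))%C ->
  is_derive_C
    (fun x => Csum (fun k => RtoC (neg_binomial s k) * E x * Cpow (w x) k)%C n) t
    (- (q * E t * RtoC ((s + INR n) * neg_binomial s n) * Cpow (w t) n))%C.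
Proof.
  intros HE Hw.
  assert (Hterm : forall k, is_derive_C
    (fun x => RtoC (neg_binomial s k) * E x * Cpow (w x) k)%C t
    (- q * E t * RtoC (neg_binomial s k) *
      (RtoC (s + INR k) * Cpow (w t) k + RtoC (INR k) * Cpow (w t) (pred k)))%C).
  { intros k.
    assert (Hc := is_derive_C_mult _ _ _ _ _
      (is_derive_C_const (RtoC (neg_binomial s k)) t) HE).
    assert (Hp := is_derive_C_mult _ _ _ _ _ Hc (is_derive_C_pow _ _ _ k Hw)).
    apply (is_derive_C_eq _ _ _ _ Hp).
    rewrite RtoC_plus.
    destruct k as [|k]; cbn [pred]; [simpl; ring | rewrite !Cpow_S; ring]. }
  induction n as [|n IH].
  - apply (is_derive_C_ext
      (fun x => RtoC (neg_binomial s 0) * E x * Cpow (w x) 0)%C).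
    { intros x. now rewrite Csum_0. }
    specialize (Hterm 0%nat).
    apply (is_derive_C_eq _ _ _ _ Hterm).
    rewrite RtoC_mult. simpl. ring.
  - apply (is_derive_C_ext (fun x =>
      Csum (fun k => RtoC (neg_binomial s k) * E x * Cpow (w x) k)%C n +
      RtoC (neg_binomial s (S n)) * E x * Cpow (w x) (S n))%C).
    { intros x. now rewrite Csum_S. }
    assert (Hsum := is_derive_C_plus _ _ _ _ _ IH (Hterm (S n))).
    apply (is_derive_C_eq _ _ _ _ Hsum).
    (* this makes the last power of the sum up to [n] cancel *)
    assert (Hrec : (s + INR n) * neg_binomial s n =
      - (neg_binomial s (S n) * INR (S n))).
    { cbn [neg_binomial]. field. apply not_0_INR. lia. }
    rewrite Hrec. cbn [pred].
    rewrite RtoC_opp, !RtoC_mult, RtoC_plus. ring.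
Qed.

(** Along the segment [Re z >= delta / 2], hence [|L / z| <= 1 / (2 (1 + s))],
    and the powers of [1 / (2 (1 + s))] absorb the growth [(1 + s) ^ n] of the
    coefficients, leaving [(1 / 2) ^ n]. *)
Lemma binomial_remainder (s delta : R) (b L : C) (n : nat) :
  0 <= s -> 0 < delta -> delta <= Re b -> Cmod L <= delta / (4 * (1 + s)) ->
  Cmod (/ Cpower (b + L) s -
        Csum (fun k => RtoC (neg_binomial s k) * / Cpower b s * Cpow (L / b) k) n)%C
  <= 2 * (s * exp (- s * ln (delta / 2))) * (1 / 2) ^ n.
Proof.
  intros Hs Hd Hb HL.
  set (z := fun t : R => (b + RtoC t * L)%C).
  set (w := fun t : R => (RtoC (1 - t) * (L * / z t))%C).
  assert (HL' : Cmod L <= delta / 4).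
  { eapply Rle_trans; [exact HL|]. apply Rle_div_l; [lra|].
    replace (delta / 4 * (4 * (1 + s))) with (delta * (1 + s)) by field. nra. }
  assert (Hz : forall t, 0 <= t <= 1 -> delta / 2 <= Re (z t)).
  { intros t Ht. unfold z.
    replace (Re (b + RtoC t * L)) with (Re b + t * Re L)
      by (unfold Re; simpl; ring).
    pose proof (re_le_Cmod L) as HR. apply Rabs_le_between in HR. nra. }
  assert (Hdz : forall t, is_derive_C z t L).
  { intros t. unfold z.
    assert (H := is_derive_C_plus _ _ _ _ _ (is_derive_C_const b t)
      (is_derive_C_mult _ _ _ _ _ (is_derive_C_RtoC (fun x => x) t 1 (is_derive_id t))
        (is_derive_C_const L t))).
    apply (is_derive_C_eq _ _ _ _ H).
    ring. }
  assert (Hq : forall t, 0 <= t <= 1 -> Cmod (L / z t) <= / (2 * (1 + s))).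
  { intros t Ht. pose proof (Hz t Ht) as Hzt.
    rewrite Cmod_div by (apply Re_pos_neq_0; lra).
    pose proof (Re_le_Cmod (z t)).
    apply Rle_div_l; [lra|].
    eapply Rle_trans; [exact HL|].
    replace (delta / (4 * (1 + s))) with (/ (2 * (1 + s)) * (delta / 2)) by (field; lra).
    apply Rmult_le_compat_l; [left; apply Rinv_0_lt_compat; lra | lra]. }
  set (T := fun t => Csum (fun k =>
    RtoC (neg_binomial s k) * / Cpower (z t) s * Cpow (w t) k)%C n).
  (* [w 1 = 0], so only the term of index 0 is left *)
  assert (HT1 : T 1 = (/ Cpower (b + L) s)%C).
  { unfold T.
    assert (Hw1 : w 1 = 0%C) by (unfold w; rewrite Rminus_diag; ring).
    replace (z 1) with (b + L)%C by (unfold z; ring). rewrite Hw1.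
    clear. induction n as [|n IH].
    - rewrite Csum_0. simpl. ring.
    - rewrite Csum_S, IH, Cpow_S. ring. }
  assert (HT0 : T 0 =
    Csum (fun k => RtoC (neg_binomial s k) * / Cpower b s * Cpow (L / b) k)%C n).
  { unfold T, w. rewrite Rminus_0_r.
    replace (z 0) with b by (unfold z; ring).
    now rewrite Cmult_1_l. }
  rewrite <- HT1, <- HT0, Rmult_assoc.
  apply (Cmod_increment_le T (fun t => - (L / z t * / Cpower (z t) s *
    RtoC ((s + INR n) * neg_binomial s n) * Cpow (w t) n))%C).
  intros t Ht. pose proof (Hz t Ht) as Hzt. pose proof (Hq t Ht) as Hqt.
  assert (Hzt0 : z t <> 0%C) by (apply Re_pos_neq_0; lra).
  split.
  - apply (telescoping_derivative (fun x => / Cpower (z x) s)%C w t s (L / z t)%C n).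
    + apply is_derive_C_inv_power; [apply Hdz | lra].
    + assert (H1 : is_derive_C (fun x => RtoC (1 - x)) t (RtoC (- (1)))).
      { apply is_derive_C_RtoC. auto_derive; [easy | ring]. }
      assert (H2 := is_derive_C_mult _ _ _ _ _ H1 (is_derive_C_mult _ _ _ _ _
        (is_derive_C_const L t) (is_derive_C_inv _ _ _ (Hdz t) ltac:(lra)))).
      apply (is_derive_C_eq _ _ _ _ H2).
      unfold w. rewrite RtoC_minus, RtoC_opp. field. exact Hzt0.
  - rewrite Cmod_opp, !Cmod_mult, Cmod_R, Cmod_pow.
    assert (Hw : Cmod (w t) <= / (2 * (1 + s))).
    { unfold w. rewrite Cmod_mult, Cmod_R, Rabs_pos_eq by lra.
      change (L * / z t)%C with (L / z t)%C.
      pose proof (Cmod_ge_0 (L / z t)). nra. }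
    assert (Hwn : Cmod (w t) ^ n <= / (2 * (1 + s)) ^ n).
    { rewrite <- pow_inv. apply pow_incr. split; [apply Cmod_ge_0 | exact Hw]. }
    assert (Hq1 : Cmod (L / z t) <= 1).
    { eapply Rle_trans; [exact Hqt|]. rewrite <- Rinv_1.
      apply Rinv_le_contravar; lra. }
    assert (HE := Cmod_Cinv_Cpower_le (z t) s (delta / 2) Hs ltac:(lra) Hzt).
    assert (Hc := neg_binomial_tail_bound s n Hs).
    replace (s * exp (- s * ln (delta / 2)) * (1 / 2) ^ n) with
      (1 * exp (- s * ln (delta / 2)) * (s * (1 + s) ^ n) * / (2 * (1 + s)) ^ n).
    2:{ replace (1 / 2) with (/ 2) by field. rewrite Rpow_mult_distr, pow_inv.
        field. split; apply pow_nonzero; lra. }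
    repeat apply Rmult_le_compat; try assumption;
      repeat apply Rmult_le_pos; try apply Cmod_ge_0; try apply Rabs_pos.
    apply pow_le, Cmod_ge_0.
Qed.

(** * Complex-valued integrals and series *)

Notation is_CInt := (is_RInt (V := C_R_NormedModule)).

Lemma is_CInt_mult_l (x : C) (g : R -> C) (a b : R) (l : C) :
  is_CInt g a b l -> is_CInt (fun t => x * g t)%C a b (x * l)%C.
Proof.
  intros H.
  assert (H1 := is_RInt_fct_extend_fst (U := R_NormedModule) (V := R_NormedModule) _ _ _ _ H).
  assert (H2 := is_RInt_fct_extend_snd (U := R_NormedModule) (V := R_NormedModule) _ _ _ _ H).
  apply (is_RInt_fct_extend_pair (U := R_NormedModule) (V := R_NormedModule)).
  - exact (is_RInt_minus _ _ _ _ _ _ (is_RInt_scal _ _ _ (Re x) _ H1)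
      (is_RInt_scal _ _ _ (Im x) _ H2)).
  - exact (is_RInt_plus _ _ _ _ _ _ (is_RInt_scal _ _ _ (Re x) _ H2)
      (is_RInt_scal _ _ _ (Im x) _ H1)).
Qed.

Lemma is_CInt_sum (g : nat -> R -> C) (a b : R) (l : nat -> C) (n : nat) :
  (forall k, (k <= n)%nat -> is_CInt (g k) a b (l k)) ->
  is_CInt (fun t => Csum (fun k => g k t) n) a b (Csum l n).
Proof.
  induction n as [|n IH]; intros H.
  - rewrite Csum_0. apply (is_RInt_ext (g 0%nat)).
    + intros t _. now rewrite Csum_0.
    + now apply H.
  - rewrite Csum_S.
    apply (is_RInt_ext (fun t => Csum (fun k => g k t) n + g (S n) t)%C).
    + intros t _. now rewrite Csum_S.
    + apply (is_RInt_plus (V := C_R_NormedModule)); [apply IH; auto | now apply H].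
Qed.

Lemma Cmod_CInt_le (g : R -> C) (a b : R) (l : C) (B : R) :
  a <= b -> (forall t, a <= t <= b -> Cmod (g t) <= B) ->
  is_CInt g a b l -> Cmod l <= (b - a) * B.
Proof.
  intros Hab Hg Hl. rewrite Cmod_norm.
  apply (norm_RInt_le_const (V := C_R_NormedModule) g a b); [exact Hab| |exact Hl].
  intros t Ht. rewrite <- Cmod_norm. now apply Hg.
Qed.

Lemma continuous_RtoC_mult (g : R -> R) (h : R -> C) (t : R) (d : C) :
  continuous g t -> is_derive_C h t d ->
  continuous (fun x => RtoC (g x) * h x)%C t.
Proof.
  intros Hg [H1 H2].
  assert (C1 : continuous (fun x => Re (h x)) t)
    by (apply (ex_derive_continuous (V := R_NormedModule)); now exists (Re d)).
  assert (C2 : continuous (fun x => Im (h x)) t)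
    by (apply (ex_derive_continuous (V := R_NormedModule)); now exists (Im d)).
  apply (continuous_ext (fun x => (g x * Re (h x), g x * Im (h x)) : C)).
  { intros x. unfold RtoC, Cmult, Re, Im; simpl. f_equal; ring. }
  intros P [e He].
  assert (F := filter_and _ _
    (proj1 (filterlim_locally _ _) (continuous_mult (K := R_AbsRing) _ _ _ Hg C1) e)
    (proj1 (filterlim_locally _ _) (continuous_mult (K := R_AbsRing) _ _ _ Hg C2) e)).
  unfold filtermap. revert F. apply filter_imp. intros x [F1 F2].
  apply He. now split.
Qed.

Lemma is_series_C_geometric (u : nat -> C) (l : C) (K : R) :
  (forall n, Cmod (l - Csum u n) <= K * (1 / 2) ^ n) ->
  is_series (V := C_NormedModule) u l.
Proof.
  intros H. apply filterlim_locally. intros e.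
  assert (Hlim : is_lim_seq (fun n => K * (1 / 2) ^ n) 0).
  { replace (Finite 0) with (Rbar_mult K 0) by (simpl; f_equal; ring).
    apply is_lim_seq_scal_l, is_lim_seq_geom. rewrite Rabs_pos_eq; lra. }
  assert (F := proj1 (filterlim_locally _ _) Hlim e).
  revert F. apply filter_imp. intros n Hn.
  apply C_NormedModule_mixin_compat1.
  change (Cmod (Csum u n - l) < e).
  rewrite <- Cmod_opp. replace (- (Csum u n - l))%C with (l - Csum u n)%C by ring.
  eapply Rle_lt_trans; [apply H|].
  eapply Rle_lt_trans; [apply Rle_abs|].
  replace (K * (1 / 2) ^ n) with (minus (K * (1 / 2) ^ n) 0)
    by (unfold minus, plus, opp; simpl; ring).
  exact Hn.
Qed.

(** * The double power series of an integral of powers *)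

(** The coefficient of [h1 ^ k * h2 ^ m] in the expansion of
    [(b + h1 p + h2 q) ^ (- s)]. *)
Definition taylor_kernel (s : R) (b p q : C) (k m : nat) : C :=
  (RtoC (neg_binomial s (k + m) * Binomial.C (k + m) k) * / Cpower b s *
   Cpow (p / b) k * Cpow (q / b) m)%C.

Lemma taylor_kernel_sum (s : R) (b p q h1 h2 : C) (n : nat) :
  Csum (fun k => taylor_kernel s b p q k (n - k) * Cpow h1 k * Cpow h2 (n - k))%C n =
  (RtoC (neg_binomial s n) * / Cpower b s * Cpow ((h1 * p + h2 * q) / b) n)%C.
Proof.
  replace ((h1 * p + h2 * q) / b)%C with (h1 * (p / b) + h2 * (q / b))%C
    by (unfold Cdiv; ring).
  rewrite Cbinomial, <- Csum_mult_l. apply Csum_ext. intros k Hk.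
  unfold taylor_kernel. replace (k + (n - k))%nat with n by lia.
  rewrite RtoC_mult, !Cpow_mult_l. ring.
Qed.

Lemma taylor_kernel_bound (s delta : R) (b p q : C) (k m : nat) :
  0 <= s -> 0 < delta -> delta <= Re b -> Cmod p <= 1 -> Cmod q <= 1 ->
  Cmod (taylor_kernel s b p q k m) <=
  exp (- s * ln delta) * ((1 + s) / delta) ^ (k + m) * Binomial.C (k + m) k.
Proof.
  intros Hs Hd Hb Hp Hq.
  assert (Hquot : forall x, Cmod x <= 1 -> forall j, Cmod (x / b) ^ j <= (/ delta) ^ j).
  { intros x Hx j. apply pow_incr. split; [apply Cmod_ge_0|].
    rewrite Cmod_div by (apply Re_pos_neq_0; lra).
    pose proof (Re_le_Cmod b). pose proof (Cmod_ge_0 x).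
    rewrite <- (Rmult_1_l (/ delta)).
    apply Rmult_le_compat; [easy | left; apply Rinv_0_lt_compat; lra | easy |].
    apply Rinv_le_contravar; lra. }
  assert (HC : 0 <= Binomial.C (k + m) k).
  { unfold Binomial.C. apply Rdiv_le_0_compat; [apply pos_INR|].
    apply Rmult_lt_0_compat; apply INR_fact_lt_0. }
  unfold taylor_kernel.
  rewrite !Cmod_mult, !Cmod_pow, Cmod_R, Rabs_mult, (Rabs_pos_eq (Binomial.C _ _)) by exact HC.
  replace (exp (- s * ln delta) * ((1 + s) / delta) ^ (k + m) * Binomial.C (k + m) k)
    with ((1 + s) ^ (k + m) * Binomial.C (k + m) k * exp (- s * ln delta) *
          (/ delta) ^ k * (/ delta) ^ m).
  2:{ unfold Rdiv. rewrite Rpow_mult_distr, (pow_add (/ delta)). ring. }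
  assert (HE := Cmod_Cinv_Cpower_le b s delta Hs Hd Hb).
  assert (Hc := neg_binomial_bound s (k + m) Hs).
  revert HC. generalize (Binomial.C (k + m) k). intros bin HC.
  repeat apply Rmult_le_compat; auto using Rle_refl;
    repeat first [exact HC | apply Cmod_ge_0 | apply Rabs_pos |
      apply pow_le, Cmod_ge_0 | apply Rmult_le_pos].
Qed.

Definition affine (beta p q : R -> C) (a : C * C) (t : R) : C :=
  (beta t + fst a * p t + snd a * q t)%C.

Definition power_integral (g : R -> R) (beta p q : R -> C) (s lo hi : R)
    (a : C * C) : C :=
  RInt (V := C_R_CompleteNormedModule)
    (fun t => RtoC (g t) * / Cpower (affine beta p q a t) s)%C lo hi.

Definition ex_derive_C (h : R -> C) (t : R) : Prop := exists d, is_derive_C h t d.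

Lemma ex_derive_C_affine (beta p q : R -> C) (a : C * C) (t : R) :
  ex_derive_C beta t -> ex_derive_C p t -> ex_derive_C q t ->
  ex_derive_C (affine beta p q a) t.
Proof.
  intros [d0 H0] [d1 H1] [d2 H2]. unfold affine. eexists.
  apply is_derive_C_plus; [apply is_derive_C_plus|]; [exact H0| |].
  - exact (is_derive_C_mult _ _ _ _ _ (is_derive_C_const (fst a) t) H1).
  - exact (is_derive_C_mult _ _ _ _ _ (is_derive_C_const (snd a) t) H2).
Qed.

Lemma ex_CInt_mult (g : R -> R) (h : R -> C) (lo hi : R) :
  lo <= hi ->
  (forall t, lo <= t <= hi -> continuous g t /\ ex_derive_C h t) ->
  ex_RInt (V := C_R_NormedModule) (fun t => RtoC (g t) * h t)%C lo hi.
Proof.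
  intros Hle H.
  apply (ex_RInt_continuous (V := C_R_CompleteNormedModule)).
  rewrite Rmin_left, Rmax_right by exact Hle.
  intros t Ht. destruct (H t Ht) as [Hg [d Hd]].
  exact (continuous_RtoC_mult g h t d Hg Hd).
Qed.

Lemma ex_derive_C_inv_power (z : R -> C) (t s : R) :
  ex_derive_C z t -> 0 < Re (z t) -> ex_derive_C (fun x => / Cpower (z x) s)%C t.
Proof. intros [d Hd] Hz. eexists. now apply (is_derive_C_inv_power z t s d). Qed.

Lemma ex_derive_C_taylor_kernel (s : R) (b p q : R -> C) (k m : nat) (t : R) :
  ex_derive_C b t -> ex_derive_C p t -> ex_derive_C q t -> 0 < Re (b t) ->
  ex_derive_C (fun x => taylor_kernel s (b x) (p x) (q x) k m) t.
Proof.
  intros [d0 H0] [d1 H1] [d2 H2] Hb.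
  assert (Hi := is_derive_C_inv _ _ _ H0 Hb).
  eexists. unfold taylor_kernel.
  exact (is_derive_C_mult _ _ _ _ _
    (is_derive_C_mult _ _ _ _ _
      (is_derive_C_mult _ _ _ _ _
        (is_derive_C_const _ t) (is_derive_C_inv_power _ _ s _ H0 Hb))
      (is_derive_C_pow _ _ _ k (is_derive_C_mult _ _ _ _ _ H1 Hi)))
    (is_derive_C_pow _ _ _ m (is_derive_C_mult _ _ _ _ _ H2 Hi))).
Qed.

(** By the binomial theorem the terms of total degree [n] add up to at most
    [K (rho (x + y)) ^ n]. *)
Lemma double_series_bound (c : nat -> nat -> C) (K rho x y : R) :
  0 <= K -> 0 <= rho -> 0 <= x -> 0 <= y -> rho * (x + y) <= 1 / 2 ->
  (forall k m, Cmod (c k m) <= K * rho ^ (k + m) * Binomial.C (k + m) k) ->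
  ex_series (fun n => sum_n (fun k =>
    Cmod (c k (n - k)%nat) * x ^ k * y ^ (n - k)) n).
Proof.
  intros HK Hrho Hx Hy Hhalf Hc.
  apply (ex_series_le (K := R_AbsRing) (V := R_CompleteNormedModule) _
    (fun n => K * (1 / 2) ^ n)).
  - intros n. change norm with Rabs. rewrite sum_n_Reals.
    assert (Hx' : forall i, 0 <= x ^ i) by (intros i; now apply pow_le).
    assert (Hy' : forall i, 0 <= y ^ i) by (intros i; now apply pow_le).
    rewrite Rabs_pos_eq.
    2:{ apply cond_pos_sum. intros k.
        repeat apply Rmult_le_pos; auto. apply Cmod_ge_0. }
    apply Rle_trans with (K * (rho * (x + y)) ^ n).
    + rewrite Rpow_mult_distr, binomial, <- Rmult_assoc, scal_sum.
      apply sum_Rle. intros k Hk.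
      replace (Binomial.C n k * x ^ k * y ^ (n - k) * (K * rho ^ n)) with
        (K * rho ^ n * Binomial.C n k * x ^ k * y ^ (n - k)) by ring.
      specialize (Hc k (n - k)%nat). replace (k + (n - k))%nat with n in Hc by lia.
      apply Rmult_le_compat_r; [auto|]. now apply Rmult_le_compat_r.
    + apply Rmult_le_compat_l; [exact HK|]. apply pow_incr. split; [|exact Hhalf].
      apply Rmult_le_pos; lra.
  - apply (ex_series_scal (V := R_NormedModule) K), ex_series_geom.
    rewrite Rabs_pos_eq; lra.
Qed.

(** The coefficients of the power series are the integrals of [taylor_kernel]
    against [g]. The sum of the terms of total degree at most [n] is the integral
    of a partial sum of the binomial series, so its distance to the integral is at
    most the integral of the uniform bound of [binomial_remainder]. *)
Lemma analytic_at_power_integral (g : R -> R) (beta p q : R -> C)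
    (s lo hi B delta : R) (a : C * C) :
  lo <= hi -> 0 <= s -> 0 < delta ->
  (forall t, lo <= t <= hi ->
    continuous g t /\ ex_derive_C beta t /\ ex_derive_C p t /\ ex_derive_C q t) ->
  (forall t, lo <= t <= hi ->
    Rabs (g t) <= B /\ Cmod (p t) <= 1 /\ Cmod (q t) <= 1 /\
    delta <= Re (affine beta p q a t)) ->
  analytic_at (power_integral g beta p q s lo hi) a.
Proof.
  intros Hle Hs Hd Hreg Hbd.
  set (b := affine beta p q a).
  pose (c := fun k m => RInt (V := C_R_CompleteNormedModule)
    (fun t => RtoC (g t) * taylor_kernel s (b t) (p t) (q t) k m)%C lo hi).
  assert (HB : 0 <= B).
  { destruct (Hbd lo) as [H _]; [lra|]. pose proof (Rabs_pos (g lo)). lra. }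
  assert (Hc : forall k m, is_CInt
    (fun t => RtoC (g t) * taylor_kernel s (b t) (p t) (q t) k m)%C lo hi (c k m)).
  { intros k m. apply (RInt_correct (V := C_R_CompleteNormedModule)).
    apply ex_CInt_mult; [exact Hle|]. intros t Ht.
    destruct (Hreg t Ht) as (R1 & R2 & R3 & R4).
    destruct (Hbd t Ht) as (_ & _ & _ & B4).
    split; [exact R1|].
    apply ex_derive_C_taylor_kernel; try assumption.
    - now apply ex_derive_C_affine.
    - unfold b. lra. }
  assert (Hgeom : 0 < delta / (8 * (1 + s))) by (apply Rdiv_lt_0_compat; lra).
  exists (delta / (8 * (1 + s))), c. split; [exact Hgeom|].
  intros h1 h2 Hh1 Hh2.
  pose proof (Cmod_ge_0 h1) as P1. pose proof (Cmod_ge_0 h2) as P2.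
  assert (Hsplit : delta / (4 * (1 + s)) = 2 * (delta / (8 * (1 + s)))) by (field; lra).
  split.
  - apply (double_series_bound c ((hi - lo) * (B * exp (- s * ln delta)))
      ((1 + s) / delta)); try assumption.
    + repeat apply Rmult_le_pos; try lra. left; apply exp_pos.
    + apply Rdiv_le_0_compat; lra.
    + apply Rle_trans with ((1 + s) / delta * (delta / (4 * (1 + s)))).
      * apply Rmult_le_compat_l; [apply Rdiv_le_0_compat|]; lra.
      * replace ((1 + s) / delta * (delta / (4 * (1 + s)))) with (1 / 4) by (field; lra).
        lra.
    + intros k m.
      replace ((hi - lo) * (B * exp (- s * ln delta)) * ((1 + s) / delta) ^ (k + m) *
        Binomial.C (k + m) k) with ((hi - lo) * (B * (exp (- s * ln delta) *
        ((1 + s) / delta) ^ (k + m) * Binomial.C (k + m) k))) by ring.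
      refine (Cmod_CInt_le _ _ _ _ _ Hle _ (Hc k m)).
      intros t Ht. destruct (Hbd t Ht) as (B1 & B2 & B3 & B4).
      rewrite Cmod_mult, Cmod_R.
      apply Rmult_le_compat; try apply Rabs_pos; try apply Cmod_ge_0; [exact B1|].
      now apply taylor_kernel_bound.
  - apply (is_series_C_geometric _ _
      ((hi - lo) * (B * (2 * (s * exp (- s * ln (delta / 2))))))).
    intros n.
    rewrite Rmult_assoc, (Rmult_assoc B).
    set (a' := ((fst a + h1)%C, (snd a + h2)%C)).
    set (L := fun t => (h1 * p t + h2 * q t)%C).
    assert (Ha' : forall t, affine beta p q a' t = (b t + L t)%C).
    { intros t. unfold b, L, affine, a'. simpl fst; simpl snd. ring. }
    assert (HL : forall t, lo <= t <= hi -> Cmod (L t) <= delta / (4 * (1 + s))).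
    { intros t Ht. destruct (Hbd t Ht) as (_ & B2 & B3 & _).
      unfold L. eapply Rle_trans; [apply Cmod_triangle|]. rewrite !Cmod_mult.
      pose proof (Cmod_ge_0 (p t)). pose proof (Cmod_ge_0 (q t)). nra. }
    (* keeps the shifted base in the right half-plane *)
    assert (HL4 : delta / (4 * (1 + s)) <= delta / 4).
    { apply Rmult_le_compat_l; [lra|]. apply Rinv_le_contravar; lra. }
    assert (HF : is_CInt (fun t => RtoC (g t) * / Cpower (affine beta p q a' t) s)%C
      lo hi (power_integral g beta p q s lo hi a')).
    { apply (RInt_correct (V := C_R_CompleteNormedModule)).
      apply ex_CInt_mult; [exact Hle|]. intros t Ht.
      destruct (Hreg t Ht) as (R1 & R2 & R3 & R4).
      destruct (Hbd t Ht) as (_ & _ & _ & B4).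
      split; [exact R1|]. apply ex_derive_C_inv_power.
      - now apply ex_derive_C_affine.
      - rewrite Ha'. pose proof (HL t Ht) as HLt.
        pose proof (re_le_Cmod (L t)) as HR. apply Rabs_le_between in HR.
        change (0 < Re (b t) + Re (L t)). unfold b. lra. }
    assert (Hdegree : forall j, is_CInt (fun t => RtoC (g t) *
        (RtoC (neg_binomial s j) * / Cpower (b t) s * Cpow (L t / b t) j))%C lo hi
      (Csum (fun k => c k (j - k)%nat * Cpow h1 k * Cpow h2 (j - k)) j)%C).
    { intros j.
      apply (is_RInt_ext (fun t => Csum (fun k => Cpow h1 k * Cpow h2 (j - k) *
        (RtoC (g t) * taylor_kernel s (b t) (p t) (q t) k (j - k))) j)%C).
      - intros t _. unfold L. rewrite <- taylor_kernel_sum, <- Csum_mult_l.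
        apply Csum_ext. intros k _. ring.
      - rewrite (Csum_ext _ (fun k => Cpow h1 k * Cpow h2 (j - k) * c k (j - k)%nat)%C)
          by (intros k _; ring).
        apply is_CInt_sum. intros k _. now apply is_CInt_mult_l. }
    refine (Cmod_CInt_le _ _ _ _ _ Hle _ (is_RInt_minus (V := C_R_NormedModule)
      _ _ _ _ _ _ HF (is_CInt_sum _ _ _ _ n (fun j _ => Hdegree j)))).
    intros t Ht. destruct (Hbd t Ht) as (B1 & _ & _ & B4).
    rewrite Csum_mult_l, Ha'.
    match goal with |- Cmod (minus (?x * ?y)%C (?x * ?z)%C) <= _ =>
      change (Cmod (x * y - x * z)%C <= B * (2 * (s * exp (- s * ln (delta / 2))) * (1 / 2) ^ n));
      replace (x * y - x * z)%C with (x * (y - z))%C by ring end.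
    rewrite Cmod_mult, Cmod_R.
    apply Rmult_le_compat; try apply Rabs_pos; try apply Cmod_ge_0; [exact B1|].
    apply binomial_remainder; auto.
Qed.

(** * The base and the weight on the arc *)

Definition integral_beta (eps : R) (_ : R) : C := RtoC eps.
Definition integral_p (phi : R) : C := (- Ci * RtoC (cos phi))%C.
Definition integral_q (phi : R) : C := (- Ci * RtoC (sin phi))%C.

Lemma base_affine (eps : R) (a : C * C) (phi : R) :
  base eps a phi = affine (integral_beta eps) integral_p integral_q a phi.
Proof.
  destruct a as [[x1 y1] [x2 y2]].
  unfold base, affine, integral_beta, integral_p, integral_q, Ci, RtoC, Copp, Cmult, Cplus.
  simpl. f_equal; ring.
Qed.

Lemma Re_base (eps : R) (a : C * C) (phi : R) :
  Re (base eps a phi) = eps + Im (fst a) * cos phi + Im (snd a) * sin phi.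
Proof. unfold base, Re, Im; simpl; ring. Qed.

(** Since [cos phi] and [- sin phi] lie between 0 and 1, each of the two terms
    lowers the real part by at most [m]. *)
Lemma Re_base_lower_bound (eps m : R) (a : C * C) (phi : R) :
  0 <= m -> - m <= Im (fst a) -> Im (snd a) <= m ->
  3 * PI / 2 <= phi <= 2 * PI ->
  eps - 2 * m <= Re (base eps a phi).
Proof.
  intros Hm H1 H2 Hphi. rewrite Re_base.
  assert (Hc : 0 <= cos phi) by (apply cos_ge_0_3PI2; lra).
  assert (Hs : sin phi <= 0) by (pose proof PI_RGT_0; apply sin_le_0; lra).
  pose proof (COS_bound phi). pose proof (SIN_bound phi). nra.
Qed.

Lemma integrand_power (f : R -> R -> R) (nu eps : R) (a : C * C) (phi : R) :
  integrand f nu eps a phi =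
  (RtoC (f (PI / 2)%R phi) *
   / Cpower (affine (integral_beta eps) integral_p integral_q a phi) (nu + 3 / 2)%R)%C.
Proof. unfold integrand. now rewrite base_affine. Qed.

Lemma ex_derive_C_integral_coefficients (eps t : R) :
  ex_derive_C (integral_beta eps) t /\ ex_derive_C integral_p t /\
  ex_derive_C integral_q t.
Proof.
  unfold integral_beta, integral_p, integral_q.
  split; [|split]; eexists.
  - apply is_derive_C_const.
  - apply is_derive_C_mult; [apply is_derive_C_const|].
    apply is_derive_C_RtoC, is_derive_Reals, derivable_pt_lim_cos.
  - apply is_derive_C_mult; [apply is_derive_C_const|].
    apply is_derive_C_RtoC, is_derive_Reals, derivable_pt_lim_sin.
Qed.

Lemma Cmod_integral_coefficients (t : R) :
  Cmod (integral_p t) <= 1 /\ Cmod (integral_q t) <= 1.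
Proof.
  unfold integral_p, integral_q. rewrite !Cmod_mult, !Cmod_opp, Cmod_Ci, !Cmod_R.
  split; rewrite Rmult_1_l; apply Rabs_le; [apply COS_bound | apply SIN_bound].
Qed.

Lemma norm3_spherical (theta phi : R) : norm3 (spherical theta phi) = 1.
Proof.
  unfold norm3, spherical; simpl fst; simpl snd.
  pose proof (sin2_cos2 theta) as H1. pose proof (sin2_cos2 phi) as H2.
  unfold Rsqr in *.
  replace ((sin theta * cos phi) ^ 2 + (sin theta * sin phi) ^ 2 + cos theta ^ 2)
    with (sin theta * sin theta * (sin phi * sin phi + cos phi * cos phi) +
      cos theta * cos theta) by ring.
  rewrite H2, Rmult_1_r, H1. apply sqrt_1.
Qed.

(** The continuity on the whole sphere, cut included, covers the end point
    [2 * PI], where the smoothness assumption stops. *)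
Lemma eigenfunction_continuous (l : R) (u : point3 -> R) (theta phi : R) :
  dirichlet_eigenpair l u -> continuous (fun x => u (spherical theta x)) phi.
Proof.
  intros [Hu _].
  apply (continuous_ext (fun x => extend u (spherical theta x))).
  { intros x. unfold extend, normalize. rewrite norm3_spherical.
    unfold spherical; simpl fst; simpl snd. now rewrite !Rdiv_1_r. }
  apply (continuous_comp (spherical theta) (extend u)).
  - assert (Hc : forall h : R -> R, ex_derive h phi -> continuous h phi).
    { intros h. apply (ex_derive_continuous (V := R_NormedModule)). }
    assert (H1 : continuous (fun x => sin theta * cos x) phi)
      by (apply Hc; auto_derive; easy).
    assert (H2 : continuous (fun x => sin theta * sin x) phi)
      by (apply Hc; auto_derive; easy).
    intros P [e He].
    assert (F := filter_and _ _ (proj1 (filterlim_locally _ _) H1 e)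
      (proj1 (filterlim_locally _ _) H2 e)).
    unfold filtermap. revert F. apply filter_imp. intros x [F1 F2].
    apply He. split; [now split|]. apply ball_center.
  - apply Hu. rewrite norm3_spherical. lra.
Qed.

(** The end point [phi = 2 * PI] is the point [phi = 0] of the cut, where the
    eigenfunction vanishes. *)
Lemma eigenfunction_bound (u : point3 -> R) (phi : R) :
  let f := fun theta phi => u (spherical theta phi) in
  eigenfunction_properties f -> 3 * PI / 2 <= phi <= 2 * PI ->
  Rabs (f (PI / 2) phi) <= 1.
Proof.
  intros f (Hcut & _ & Hpos & _) Hphi. pose proof PI_RGT_0.
  destruct (Rle_lt_or_eq_dec phi (2 * PI)) as [Hlt | ->]; [lra| |].
  - destruct (Hpos phi); [lra|]. rewrite Rabs_pos_eq; lra.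
  - replace (f (PI / 2) (2 * PI)) with (f (PI / 2) 0).
    + rewrite Hcut by lra. rewrite Rabs_R0. lra.
    + unfold f, spherical. now rewrite cos_2PI, sin_2PI, cos_0, sin_0.
Qed.

Lemma analytic_at_ext (F G : C * C -> C) (a : C * C) :
  (forall x, F x = G x) -> analytic_at F a -> analytic_at G a.
Proof.
  intros HFG (r & c & Hr & H). exists r, c. split; [exact Hr|].
  intros h1 h2 H1 H2. rewrite <- HFG. now apply H.
Qed.

(** * Analyticity of the integral *)

Theorem mainTheorem1 :
  forall (A1 A2 : R -> C) (M : R) (l1 : R) (u : point3 -> R) (eps : R),
    let f := fun theta phi => u (spherical theta phi) in
    let nu := sqrt (l1 + 1 / 4) in
    let D := fun a : C * C => UHP A1 (fst a) /\ LHP A2 (snd a) in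
    is_contour A1 ->
    is_contour A2 ->
    0 < M ->
    (forall a1, UHP A1 a1 -> - M <= Im a1) ->
    (forall a2, LHP A2 a2 -> Im a2 <= M) ->
    first_dirichlet_eigenpair l1 u ->
    eigenfunction_properties f ->
    2 * M < eps ->
    (forall a phi, D a -> 3 * PI / 2 <= phi <= 2 * PI ->
       0 < Re (base eps a phi)) /\
    (forall a, D a ->
       ex_RInt (V := C_R_NormedModule)
         (integrand f nu eps a) (3 * PI / 2) (2 * PI)) /\
    analytic_on D (I_pm f nu eps).
Proof.
  intros A1 A2 M l1 u eps f nu D _ _ HM HA1 HA2 [Hu _] Hf Heps.
  assert (Hpos : forall a phi, D a -> 3 * PI / 2 <= phi <= 2 * PI ->
    0 < Re (base eps a phi)).
  { intros a phi [D1 D2] Hphi.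
    pose proof (Re_base_lower_bound eps M a phi ltac:(lra) (HA1 _ D1) (HA2 _ D2) Hphi).
    lra. }
  assert (Hle : 3 * PI / 2 <= 2 * PI) by (pose proof PI_RGT_0; lra).
  assert (Hcont : forall phi, continuous (f (PI / 2)) phi)
    by (intros phi; exact (eigenfunction_continuous l1 u (PI / 2) phi Hu)).
  split; [exact Hpos|split].
  - intros a Da.
    apply (ex_RInt_ext (fun t => RtoC (f (PI / 2)%R t) *
      / Cpower (affine (integral_beta eps) integral_p integral_q a t) (nu + 3 / 2)%R)%C).
    { intros t _. now rewrite integrand_power. }
    apply ex_CInt_mult; [exact Hle|]. intros t Ht.
    destruct (ex_derive_C_integral_coefficients eps t) as (E1 & E2 & E3).
    split; [apply Hcont|]. apply ex_derive_C_inv_power.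
    + now apply ex_derive_C_affine.
    + rewrite <- base_affine. now apply Hpos.
  (* any [m] strictly between [M] and [eps / 2] gives an open neighbourhood *)
  - pose (m := (M + eps / 2) / 2).
    assert (Hm : M < m < eps / 2) by (unfold m; lra).
    exists (fun a => - m < Im (fst a) /\ Im (snd a) < m). split; [|split].
    + apply open_and.
      * apply (open_comp (fun a : C * C => Im (fst a)) (fun y => - m < y)).
        { intros a _. apply (continuous_comp fst Im);
            [apply continuous_fst | apply continuous_snd]. }
        apply open_gt.
      * apply (open_comp (fun a : C * C => Im (snd a)) (fun y => y < m)).
        { intros a _. apply (continuous_comp snd Im); apply continuous_snd. }
        apply open_lt.
    + intros a [D1 D2]. specialize (HA1 _ D1). specialize (HA2 _ D2). lra.
    + intros a [W1 W2].
      apply (analytic_at_ext (power_integral (f (PI / 2)) (integral_beta eps)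
        integral_p integral_q (nu + 3 / 2) (3 * PI / 2) (2 * PI))).
      { intros x. unfold power_integral, I_pm.
        apply (RInt_ext (V := C_R_CompleteNormedModule)). intros t _. symmetry. apply integrand_power. }
      apply (analytic_at_power_integral _ _ _ _ _ _ _ 1 (eps - 2 * m)).
      * exact Hle.
      * pose proof (sqrt_pos (l1 + 1 / 4)). unfold nu. lra.
      * lra.
      * intros t _. split; [apply Hcont | apply ex_derive_C_integral_coefficients].
      * intros t Ht. split; [now apply eigenfunction_bound|].
        destruct (Cmod_integral_coefficients t) as [N1 N2].
        split; [exact N1|]. split; [exact N2|].
        rewrite <- base_affine. apply Re_base_lower_bound; lra.
Qed.
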